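(* Let $G$ be a Roelcke precompact closed subgroup of $\mathrm{Sym}(\omega)$. Then the group $\mathrm{Inn}(G)$ of inner automorphisms of $G$ is closed in $\mathrm{Aut}(G)$.
   Context: $\mathrm{Sym}(\omega)$ is the Polish group of permutations of $\omega$, where a neighbourhood basis of $1$ is given by the pointwise stabilisers of finite sets; its closed subgroups are, up to topological isomorphism, the non-Archimedean Polish groups. A closed subgroup $G$ of $\mathrm{Sym}(\omega)$ is Roelcke precompact if each open subgroup $U$ of $G$ has only finitely many double cosets $UgU$, $g\in G$. $\mathrm{Aut}(G)$ denotes the group of continuous automorphisms of $G$. It carries the group topology for which a neighbourhood basis of the identity consists of the subgroups $\{\Phi\in\mathrm{Aut}(G): \Phi(A_i)=A_i \text{ for } i=1,\dots,n\}$, where $A_1,\dots,A_n$ are cosets of open subgroups of $G$. *)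

(* Defs.v *)
From HB Require Import structures.
From mathcomp Require Import all_boot.
From mathcomp Require Import all_classical topology.

Set Implicit Arguments.
Unset Strict Implicit.
Unset Printing Implicit Defensive.

Local Open Scope classical_set_scope.
Local Open Scope group_scope.

HB.mixin Record Group_isTopologicalGroup G of Group G & Topological G := {
  mulg_continuous : continuous (fun xy : G * G => xy.1 * xy.2);
  invg_continuous : continuous (fun x : G => x^-1)
}.

#[short(type="topologicalGroupType")]
HB.structure Definition TopologicalGroup :=
  { G of Group G & Topological G & Group_isTopologicalGroup G }.

Section SubgroupsAndCosets.
Variable G : topologicalGroupType.

Definition open_subgroup (U : set G) := group_closed (mem U) /\ open U.

Definition lcoset (g : G) (U : set G) : set G := [set g * u | u in U].

(* A right coset [U g] of an open subgroup is the left coset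
   [g (g^-1 U g)] of an open subgroup, so this covers both kinds of cosets. *)
Definition open_coset (A : set G) :=
  exists g U, open_subgroup U /\ A = lcoset g U.

Definition double_coset (U : set G) (g : G) : set G :=
  [set z | exists u v, [/\ U u, U v & z = u * g * v]].

Definition roelcke_precompact :=
  forall U : set G, open_subgroup U -> finite_set (range (double_coset U)).

End SubgroupsAndCosets.

Arguments roelcke_precompact G : clear implicits.

Section Automorphisms.
Variable G : topologicalGroupType.

(* Continuity of the inverse is not part of the definition: when [G] is Polish
   it follows from the open mapping theorem. *)
Record caut := CAut {
  caut_fun :> G -> G;
  cautM : {morph caut_fun : x y / x * y};
  caut_bij : bijective caut_fun;
  caut_continuous : continuous caut_fun
}.

Lemma caut_inj (Phi Psi : caut) : Phi =1 Psi -> Phi = Psi.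
Proof.
case: Phi Psi => [f fM fb fc] [g gM gb gc] /= /funext fg; subst g.
by congr CAut; exact: Prop_irrelevance.
Qed.

HB.instance Definition _ := gen_eqMixin caut.
HB.instance Definition _ := gen_choiceMixin caut.

Definition caut_id : caut.
Proof.
by apply: (@CAut id) => //; [exists id|move=> x; exact: cvg_id].
Defined.

Definition caut_comp (Phi Psi : caut) : caut.
Proof.
apply: (@CAut (Phi \o Psi)).
- by move=> x y /=; rewrite !cautM.
- by apply: bij_comp; exact: caut_bij.
- by move=> x; apply: continuous_comp; exact: caut_continuous.
Defined.

Lemma caut_compA : associative caut_comp.
Proof. by move=> f g h; apply: caut_inj. Qed.

Lemma caut_comp1 : left_id caut_id caut_comp.
Proof. by move=> f; apply: caut_inj. Qed.

Lemma caut_comp1r : right_id caut_id caut_comp.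
Proof. by move=> f; apply: caut_inj. Qed.

HB.instance Definition _ :=
  isMonoid.Build caut caut_compA caut_comp1 caut_comp1r.

Definition caut_stab (C : set (set G)) : set caut :=
  [set Phi | forall A, C A -> Phi @` A = A].

(* The basic neighbourhoods of [Phi] are the translates [Phi N] of the basic
   neighbourhoods [N] of the identity. *)
Definition caut_nbhs (Phi : caut) : set_system caut :=
  filter_from [set C | finite_set C /\ C `<=` open_coset (G := G)]
              (fun C => [set Phi * Psi | Psi in caut_stab C]).

HB.instance Definition _ := hasNbhs.Build caut caut_nbhs.

Lemma caut_stab1 C : caut_stab C 1.
Proof. by move=> A _; rewrite /= image_id. Qed.

Lemma caut_stabM C Phi Psi :
  caut_stab C Phi -> caut_stab C Psi -> caut_stab C (Phi * Psi).
Proof.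
move=> sPhi sPsi A As.
by rewrite -[RHS](sPhi _ As) -{2}(sPsi _ As) image_comp.
Qed.

Let caut_nbhs_filter Phi : ProperFilter (caut_nbhs Phi).
Proof.
apply: filter_from_proper => [|C _]; last first.
  by exists (Phi * 1); exists 1 => //; exact: caut_stab1.
apply: filter_from_filter; first by exists set0; split=> //; exact: sub0set.
move=> C D [finC oC] [finD oD]; exists (C `|` D).
  by split; [rewrite finite_setU|rewrite subUset].
move=> _ [Psi CDPsi <-].
by split; exists Psi => // A ?; apply: CDPsi; [left|right].
Qed.

Let caut_nbhs_singleton Phi (A : set caut) : caut_nbhs Phi A -> A Phi.
Proof.
by move=> [s sc]; apply; exists 1; [exact: caut_stab1|rewrite mulg1].
Qed.

Let caut_nbhs_nbhs Phi (A : set caut) :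
  caut_nbhs Phi A -> caut_nbhs Phi (caut_nbhs^~ A).
Proof.
move=> [s sc sA]; exists s => // _ [Psi sPsi <-]; exists s => // _ [X sX <-].
by apply: sA; exists (Psi * X); [exact: caut_stabM|rewrite mulgA].
Qed.

HB.instance Definition _ := Nbhs_isNbhsTopological.Build caut
  caut_nbhs_filter caut_nbhs_singleton caut_nbhs_nbhs.

Definition Inn : set caut :=
  [set Phi | exists g : G, forall x, Phi x = g * x * g^-1].

End Automorphisms.

Arguments caut G : clear implicits.
Arguments Inn G : clear implicits.

Record Sym := MkSym {
  sym_fun :> nat -> nat;
  sym_inv : nat -> nat;
  sym_funK : cancel sym_fun sym_inv;
  sym_invK : cancel sym_inv sym_fun
}.

Lemma sym_inj (s t : Sym) : s =1 t -> s = t.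
Proof.
case: s t => [f f' fK f'K] [g g' gK g'K] /= /funext fg; subst g.
have fg' : f' = g' by apply/funext => x; rewrite -{1}(g'K x) fK.
by subst g'; congr MkSym; exact: Prop_irrelevance.
Qed.

HB.instance Definition _ := gen_eqMixin Sym.
HB.instance Definition _ := gen_choiceMixin Sym.

Definition sym_one : Sym := @MkSym id id (fun=> erefl) (fun=> erefl).

Definition sym_mul (s t : Sym) : Sym :=
  MkSym (can_comp (sym_funK s) (sym_funK t))
        (can_comp (sym_invK t) (sym_invK s)).

Definition sym_V (s : Sym) : Sym := MkSym (sym_invK s) (sym_funK s).

Lemma sym_mulA : associative sym_mul.
Proof. by move=> r s t; apply: sym_inj. Qed.

Lemma sym_mul1 : left_id sym_one sym_mul.
Proof. by move=> s; apply: sym_inj. Qed.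

Lemma sym_mulr1 : right_id sym_one sym_mul.
Proof. by move=> s; apply: sym_inj. Qed.

Lemma sym_mulV : left_inverse sym_one sym_V sym_mul.
Proof. by move=> s; apply: sym_inj => x /=; rewrite sym_funK. Qed.

Lemma sym_mulrV : right_inverse sym_one sym_V sym_mul.
Proof. by move=> s; apply: sym_inj => x /=; rewrite sym_invK. Qed.

HB.instance Definition _ :=
  isGroup.Build Sym sym_mulA sym_mul1 sym_mulr1 sym_mulV sym_mulrV.

Definition pstab (F : seq nat) : set Sym :=
  [set t | forall i, i \in F -> t i = i].

Definition sym_nbhs (s : Sym) : set_system Sym :=
  filter_from setT (fun F => [set s * t | t in pstab F]).

HB.instance Definition _ := hasNbhs.Build Sym sym_nbhs.

Lemma sym_nbhs_filter s : ProperFilter (sym_nbhs s).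
Proof.
apply: filter_from_proper => [|F _]; last by exists (s * 1); exists 1.
apply: filter_from_filter => [|E F _ _]; first by exists [::].
exists (E ++ F) => // _ [t tEF <-].
by split; exists t => // i iF; apply: tEF; rewrite mem_cat iF ?orbT.
Qed.

Lemma sym_nbhs_singleton s (A : set Sym) : sym_nbhs s A -> A s.
Proof. by move=> [F _]; apply; exists 1 => //; rewrite mulg1. Qed.

Lemma sym_nbhs_nbhs s (A : set Sym) : sym_nbhs s A -> sym_nbhs s (sym_nbhs^~ A).
Proof.
move=> [F _ FA]; exists F => // _ [t tF <-]; exists F => // _ [u uF <-].
apply: FA; exists (t * u); last by rewrite mulgA.
by move=> i iF /=; rewrite uF ?tF.
Qed.

HB.instance Definition _ := Nbhs_isNbhsTopological.Build Sym
  sym_nbhs_filter sym_nbhs_singleton sym_nbhs_nbhs.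

Lemma sym_nbhsP (s : Sym) (F : seq nat) :
  [set s * t | t in pstab F] = [set t : Sym | {in F, t =1 s}].
Proof.
apply/seteqP; split => [_ [t tF <-] i iF /=|t ts /=]; first by rewrite tF.
exists (s^-1 * t); last by rewrite mulVKg.
by move=> i /ts /= ->; rewrite sym_funK.
Qed.

Lemma sym_mul_continuous : continuous (fun xy : Sym * Sym => xy.1 * xy.2).
Proof.
move=> [s t] A [F _ /=]; rewrite sym_nbhsP => FA.
exists ([set s * x | x in pstab (map t F)], [set t * x | x in pstab F]).
  by split => /=; eexists=> //; exact: subset_refl.
move=> [x y] []; rewrite !sym_nbhsP => xs yt; apply: FA => i iF /=.
by rewrite yt// xs// map_f.
Qed.

Lemma sym_inv_continuous : continuous (fun x : Sym => x^-1).
Proof.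
move=> s A [F _ /=]; rewrite sym_nbhsP => FA.
exists (map (sym_inv s) F) => // y; rewrite sym_nbhsP => ys.
apply: FA => i iF /=; apply: (can_inj (sym_funK y)).
by rewrite sym_invK ys ?map_f// sym_invK.
Qed.

HB.instance Definition _ := Group_isTopologicalGroup.Build Sym
  sym_mul_continuous sym_inv_continuous.

Record closedSubgroup (T : topologicalGroupType) := ClosedSubgroup {
  csg_set :> set T;
  csg_group : group_closed (mem csg_set);
  csg_closed : closed csg_set
}.

Section ClosedSubgroup.
Variables (T : topologicalGroupType) (G : closedSubgroup T).

Let csg1 : 1 \in csg_set G.
Proof. by case: (csg_group G). Qed.

Let csgM (x y : G) : val x * val y \in csg_set G.
Proof. exact: (group_closedM (csg_group G)) (valP x) (valP y). Qed.

Let csgV (x : G) : (val x)^-1 \in csg_set G.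
Proof. exact: (group_closedV (csg_group G)) (valP x). Qed.

Definition csg_one : G := SigSub csg1.
Definition csg_mul (x y : G) : G := SigSub (csgM x y).
Definition csg_inv (x : G) : G := SigSub (csgV x).

Let csg_mulA : associative csg_mul.
Proof. by move=> x y z; apply: val_inj; rewrite /= mulgA. Qed.

Let csg_mul1 : left_id csg_one csg_mul.
Proof. by move=> x; apply: val_inj; rewrite /= mul1g. Qed.

Let csg_mulr1 : right_id csg_one csg_mul.
Proof. by move=> x; apply: val_inj; rewrite /= mulg1. Qed.

Let csg_mulV : left_inverse csg_one csg_inv csg_mul.
Proof. by move=> x; apply: val_inj; rewrite /= mulVg. Qed.

Let csg_mulrV : right_inverse csg_one csg_inv csg_mul.
Proof. by move=> x; apply: val_inj; rewrite /= mulgV. Qed.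

HB.instance Definition _ := isGroup.Build (set_type (csg_set G))
  csg_mulA csg_mul1 csg_mulr1 csg_mulV csg_mulrV.

Let csg_mul_continuous : continuous (fun xy : G * G => xy.1 * xy.2).
Proof.
apply: continuous_comp_initial => xy.
have -> : (set_val \o (fun z : G * G => z.1 * z.2)) =
  (fun z : T * T => z.1 * z.2) \o (fun z : G * G => (set_val z.1, set_val z.2)).
  by apply/funext => z; rewrite /= set_valE.
apply: continuous_comp; last exact: mulg_continuous.
apply: cvg_pair => /=; apply: (@continuous_comp _ _ _ _ (@set_val T G)).
- exact: cvg_fst.
- exact: initial_continuous.
- exact: cvg_snd.
- exact: initial_continuous.
Qed.

Let csg_inv_continuous : continuous (fun x : G => x^-1).
Proof.
apply: continuous_comp_initial => x.
have -> : (set_val \o (fun z : G => z^-1)) = (fun z : T => z^-1) \o @set_val T G.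
  by apply/funext => z; rewrite /= set_valE.
by apply: continuous_comp; [exact: initial_continuous|exact: invg_continuous].
Qed.

HB.instance Definition _ :=
  Group_isTopologicalGroup.Build (set_type (csg_set G))
    csg_mul_continuous csg_inv_continuous.

End ClosedSubgroup.

(* Main.v *)
(** Let [Phi] lie in the closure of [Inn G]. The sets
    [S A = {h | h A h^-1 = Phi A}], for [A] a coset of an open subgroup, have
    the finite intersection property, so some ultrafilter [F] on [G] contains
    all of them. If [U] is an open subgroup, then [S U] is a left coset of the
    normaliser of [U], and [k U = U k U] for [k] in the normaliser; so Roelcke
    precompactness makes [S U] a finite union of left cosets of [U], and [F]
    contains one of these. For [U] the stabiliser of [i], resp. the preimage of
    this stabiliser under [Phi], this shows that [h i], resp. [h^-1 i], is
    constant for [F]-many [h]. Hence [F] converges in Sym(omega) to some [g],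
    which is in [G] because [G] is closed. Finally [Phi] is conjugation by [g],
    since [F]-many [h] conjugate the coset of the stabiliser of [i] containing
    [x] to a set containing [Phi x]. *)
Require Import Defs.
From mathcomp Require Import all_boot finmap.
From mathcomp Require Import all_classical topology.

Set Implicit Arguments.
Unset Strict Implicit.
Unset Printing Implicit Defensive.

Local Open Scope classical_set_scope.
Local Open Scope group_scope.

(** Otherwise [F] contains the complement of every fibre of [f], hence also the intersection of the
    finitely many over values taken on [A], which misses [A]. *)
Lemma ultra_finite_image (T : Type) (U : choiceType) (F : set_system T)
    (f : T -> U) (A : set T) :
  UltraFilter F -> F A -> finite_set (f @` A) ->
  exists v, F (f @^-1` [set v]).
Proof.
move=> UF FA finA; have PF : ProperFilter F by exact: ultra_proper.
apply: contrapT => /forallNP noF.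
have FC v : F (~` (f @^-1` [set v])).
  by have [/noF|] := in_ultra_setVsetC (f @^-1` [set v]) UF.
have FI : F (\bigcap_(v in [set` fset_set (f @` A)]) ~` (f @^-1` [set v])).
  by apply: filter_bigI => v _; exact: FC.
have [x [Ax]] := filter_ex (filterI FA FI).
by move=> /(_ (f x)); apply => //=; rewrite in_fset_set// inE; exists x.
Qed.

Section Conjugators.
Variable G : topologicalGroupType.
Implicit Types (A U V : set G) (Phi : caut G).

Definition conjugators A V : set G :=
  [set h | [set h * x * h^-1 | x in A] = V].

Lemma open_subgroup1 U : open_subgroup U -> U 1.
Proof. by case=> -[U1 _] _; rewrite inE in U1. Qed.

Lemma open_subgroupM U x y : open_subgroup U -> U x -> U y -> U (x * y).
Proof.
move=> [gU _] /mem_set Ux /mem_set Uy; apply: set_mem.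
exact: (group_closedM gU Ux Uy).
Qed.

Lemma open_subgroupV U x : open_subgroup U -> U x -> U x^-1.
Proof.
move=> [gU _] /mem_set Ux; apply: set_mem; exact: (group_closedV gU Ux).
Qed.

Lemma open_subgroup_coset U : open_subgroup U -> open_coset U.
Proof.
move=> oU; exists 1, U; split=> //; rewrite /lcoset.
by under eq_imagel do rewrite mul1g; rewrite image_id.
Qed.

Lemma ultra_conjugators_lcoset U V (F : set_system G) :
  roelcke_precompact G -> open_subgroup U -> UltraFilter F ->
  F (conjugators U V) -> exists a, F (lcoset a U).
Proof.
move=> rG oU UF FUV.
have PF : ProperFilter F by exact: ultra_proper.
have [c cUV] := filter_ex FUV.
have fin : finite_set ((fun h => double_coset U (c^-1 * h)) @` conjugators U V).
  apply: sub_finite_set (rG U oU) => _ [h _ <-]; by exists (c^-1 * h).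
have [D FD] := ultra_finite_image UF FUV fin.
have [a [aUV aD]] := filter_ex (filterI FUV FD).
exists a; apply: filterS (filterI FUV FD) => h [hUV hD].
have : double_coset U (c^-1 * h) (c^-1 * h).
  by exists 1, 1; rewrite mul1g mulg1; split=> //; exact: open_subgroup1.
rewrite /= in aD hD; rewrite hD -aD => -[u [v [Uu Uv huv]]].
(* The left factor [u] is absorbed: [c * u * c^-1] lies in [V], the conjugate of [U] by [a], so it
   is [a * w * a^-1] and [h = a * w * v]. *)
have : V (c * u * c^-1) by rewrite -cUV; exists u.
rewrite -aUV => -[w Uw cua].
exists (w * v); first exact: open_subgroupM.
have -> : h = c * (c^-1 * h) by rewrite mulVKg.
rewrite huv; have -> : c * (u * (c^-1 * a) * v) = (c * u * c^-1) * a * v.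
  by rewrite !mulgA.
by rewrite -cua mulgVK mulgA.
Qed.

(** The index families are those of [caut_nbhs], so an inner automorphism in a basic neighbourhood
    of [Phi] gives a point of the matching basic set. *)
Definition conj_filter Phi : set_system G :=
  filter_from [set C | finite_set C /\ C `<=` open_coset (G := G)]
              (fun C => [set h | forall A, C A -> conjugators A (Phi @` A) h]).

Lemma conj_filter_proper Phi :
  closure (Inn G) Phi -> ProperFilter (conj_filter Phi).
Proof.
move=> clPhi; apply: filter_from_proper.
  apply: filter_from_filter; first by exists set0; split=> //; exact: sub0set.
  move=> C D [finC oC] [finD oD]; exists (C `|` D).
    by split; [rewrite finite_setU|rewrite subUset].
  by move=> h CDh; split=> A ?; apply: CDh; [left|right].
move=> C oC.
have nC : nbhs Phi [set Phi * Psi | Psi in caut_stab C] by exists C.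
have [X [[h hE] [Psi CPsi PsiE]]] := clPhi _ nC.
exists h => A CA; rewrite /conjugators /=.
(* [Psi] fixes [A], and [Phi * Psi] is conjugation by [h]. *)
rewrite -[in RHS](CPsi A CA) image_comp; apply: eq_imagel => x _.
by rewrite -hE -PsiE.
Qed.

Lemma conj_filter_conjugators Phi A :
  open_coset A -> conj_filter Phi (conjugators A (Phi @` A)).
Proof.
move=> oA; exists [set A]; first by split=> //= _ ->.
by move=> h /(_ A); apply.
Qed.

Lemma caut1 Phi : Phi 1 = 1.
Proof. by apply: (mulgI (Phi 1)); rewrite -cautM !mulg1. Qed.

Lemma cautV Phi x : Phi x^-1 = (Phi x)^-1.
Proof. by apply: (mulgI (Phi x)); rewrite -cautM !mulgV caut1. Qed.

Lemma open_subgroup_preimage Phi U :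
  open_subgroup U -> open_subgroup (Phi @^-1` U).
Proof.
move=> oU; split; last first.
  by case: oU => _; apply: open_comp => x _; exact: caut_continuous.
split; first by rewrite inE /= caut1; exact: open_subgroup1.
move=> x y; rewrite !inE /= => Ux Uy.
by rewrite cautM cautV; apply: open_subgroupM => //; exact: open_subgroupV.
Qed.

End Conjugators.

Local Notation perm h := (val h : Sym).

Section PointStabilisers.
Variable G : closedSubgroup Sym.

Definition stab (i : nat) : set G := [set h | perm h i = i].

Lemma stab_open_subgroup i : open_subgroup (stab i).
Proof.
split.
  split; first by rewrite inE.
  move=> x y; rewrite !inE /stab /= => xi yi.
  by rewrite -{1}yi sym_funK.
have -> : stab i = @set_val Sym G @^-1` [set t | t i = i].
  by apply/seteqP; split=> x; rewrite /= set_valE.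
apply: open_comp => [x _|]; first exact: initial_continuous.
rewrite openE => t ti; exists [:: i] => //; rewrite sym_nbhsP => s /= st.
by rewrite -[RHS]ti; apply: st; rewrite inE.
Qed.

(** A pointwise limit of permutations is injective but may miss points; the limit [f'] of the
    inverses makes it bijective. *)
Lemma filter_sym_lim (F : set_system G) (f f' : nat -> nat) :
  ProperFilter F ->
  (forall i, F [set h : G | perm h i = f i]) ->
  (forall i, F [set h : G | perm h^-1 i = f' i]) ->
  exists g : G, perm g =1 f /\ perm g^-1 =1 f'.
Proof.
move=> PF Ff Ff'.
have fK : cancel f f'.
  move=> i; have [h [/= hi hf]] := filter_ex (filterI (Ff i) (Ff' (f i))).
  by rewrite -hf -hi sym_funK.
have f'K : cancel f' f.
  move=> i; have [h [/= hi hf]] := filter_ex (filterI (Ff' i) (Ff (f' i))).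
  by rewrite -hf -hi sym_invK.
suff /mem_set Gg : csg_set G (MkSym fK f'K) by exists (SigSub Gg).
apply: csg_closed => B [s _ /=]; rewrite sym_nbhsP => sB.
suff Fs : F [set h : G | {in s, perm h =1 f}].
  have [h hs] := filter_ex Fs; exists (perm h).
  by split; [exact/set_mem/valP|exact: sB].
elim: {sB} s => [|i s IHs]; first by apply: filterS filterT.
apply: filterS (filterI (Ff i) IHs) => h [hi hs] j.
by rewrite inE => /predU1P[->|/hs].
Qed.

End PointStabilisers.

Theorem theorem2p7 (G : closedSubgroup Sym) :
  roelcke_precompact G -> closed (Inn G).
Proof.
move=> rG Phi clPhi.
have PF := conj_filter_proper clPhi.
have [F [UF FPhi]] := ultraFilterLemma PF.
have UPF : ProperFilter F by exact: ultra_proper.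
have Fconj A : open_coset A -> F (conjugators A (Phi @` A)).
  by move=> oA; apply: FPhi; exact: conj_filter_conjugators.
have /choice[f Ff] i : exists j, F [set h : G | perm h i = j].
  have oS := stab_open_subgroup G i.
  have FS := Fconj _ (open_subgroup_coset oS).
  have [a Fa] := ultra_conjugators_lcoset rG oS UF FS.
  by exists (perm a i); apply: filterS Fa => _ [u /= ui <-] /=; rewrite ui.
have /choice[f' Ff'] i : exists j, F [set h : G | perm h^-1 i = j].
  have oW := open_subgroup_preimage Phi (stab_open_subgroup G i).
  have FW := Fconj _ (open_subgroup_coset oW).
  have [c Fc] := ultra_conjugators_lcoset rG oW UF FW.
  (* Fix one such [a]. Any other [h] is [a * w] with [Phi w] fixing [i], so
     [h * a^-1 = a * w * a^-1] lies in the image under [Phi] of the preimage of [stab i]; hence it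
     fixes [i], and [h^-1 i = a^-1 i]. *)
  have [a [ac aW]] := filter_ex (filterI Fc FW).
  exists (perm a^-1 i); apply: filterS (filterI Fc FW) => h [hc hW].
  have [u Wu cu] := ac; have [v Wv cv] := hc.
  have Wuv : (Phi @^-1` stab i) (u^-1 * v).
    by apply: (open_subgroupM oW) => //; exact: (open_subgroupV oW).
  have hE : h = a * (u^-1 * v) by rewrite -cu -cv mulgA mulgK.
  have : [set a * x * a^-1 | x in Phi @^-1` stab i] (h * a^-1).
    by exists (u^-1 * v) => //; rewrite -hE.
  rewrite aW => -[w Ww wE].
  have hai : perm (h * a^-1) i = i by rewrite -wE; exact: Ww.
  by rewrite /= -[in LHS]hai /= sym_funK.
have [g [gf gf']] := filter_sym_lim UPF Ff Ff'.
exists g => x.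
suff xE : g^-1 * Phi x * g = x by rewrite -[in RHS]xE !mulgA mulgV mul1g mulgK.
apply: val_inj; apply: sym_inj => i.
have oxi : open_coset (lcoset x (stab i)).
  by exists x, (stab i); split=> //; exact: stab_open_subgroup.
(* This [h] agrees with [g] at [i], and [h^-1] with [g^-1] at [Phi x (g i)], so [h] may replace [g]
   when [g^-1 * Phi x * g] is evaluated at [i]. *)
have [h [[/= hi h'i] hx]] := filter_ex
  (filterI (filterI (Ff i) (Ff' (perm (Phi x) (f i)))) (Fconj _ oxi)).
have : [set Phi y | y in lcoset x (stab i)] (Phi x).
  by exists x => //; exists 1; rewrite ?mulg1.
rewrite -hx => -[_ [u ui <-] hPhi].
have hu : h^-1 * Phi x * h = x * u by rewrite -hPhi !mulgA mulVg mul1g mulgVK.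
have /= := congr1 (fun z : G => perm z i) hu.
by rewrite ui hi h'i => <-; rewrite -gf' -gf.
Qed.
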